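(* For $n \in \mathbb{N} = \{1,2,3,\ldots\}$ let $x_n := \left\{ \frac{\log(2n-1)}{\log(2)} \right\}$, and for $N\in\mathbb{N}$ and $s \ge 0$ let $$F_{N}(s) := \frac{1}{N} \# \left\{ (k,l) \ : \ 1 \leq k, l \leq N,\ k \neq l,\ \left\| x_k - x_l\right\| \leq \frac{s}{N} \right\}.$$ Then for every $s \ge 0$ the limit $F(s) := \lim_{N \to \infty} F_N(s)$ exists and is given by $$F(s) = \begin{cases} 0 & \text{if } 0 \leq s < \frac{1}{\log(4)},\\[4pt] 3k - \dfrac{3k^2+2k}{4\log(2)s} & \text{if } \frac{k}{\log(4)} \leq s < \frac{k+1}{\log(4)},\ k \in \mathbb{N} \text{ even},\\[8pt] 3k + 1 - \dfrac{3k^2+4k+1}{4\log(2)s} & \text{if } \frac{k}{\log(4)} \leq s < \frac{k+1}{\log(4)},\ k \in \mathbb{N} \text{ odd}.\end{cases}$$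
   Context: Here $\log$ is the natural logarithm, $\{\cdot\}$ denotes the fractional part of a real number, $\|\cdot\|$ denotes the distance of a real number from its nearest integer, and $\mathbb{N}$ denotes the positive integers. *)

(* Defs.v *)
From HB Require Import structures.
From mathcomp Require Import all_boot all_order all_algebra.
From mathcomp Require Import all_classical all_reals all_analysis.
Import Order.TTheory GRing.Theory Num.Theory.
Import numFieldNormedType.Exports.

Set Implicit Arguments.
Unset Strict Implicit.
Unset Printing Implicit Defensive.

Local Open Scope classical_set_scope.
Local Open Scope ring_scope.

Definition frac_part {R : realType} (x : R) : R := x - (Num.floor x)%:~R.

Definition dist_int {R : realType} (x : R) : R :=
  inf (range (fun m : int => `|x - m%:~R|)).

(* Only the values at n >= 1 are used. *)
Definition xseq (R : realType) (n : nat) : R :=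
  frac_part (ln (2 * n%:R - 1) / ln 2).

(* The indices k, l of {1, ..., N} are p.1.+1 and p.2.+1 for p.1, p.2 in
   {0, ..., N - 1}. *)
Definition pair_corr (R : realType) (s : R) (N : nat) : R :=
  N%:R^-1 *
  #|[pred p : 'I_N * 'I_N | (p.1 != p.2) &&
      (dist_int (xseq R p.1.+1 - xseq R p.2.+1) <= s / N%:R)]|%:R.

(* Main.v *)
Require Import Defs.
From HB Require Import structures.
From mathcomp Require Import all_boot all_order all_algebra.
From mathcomp Require Import all_classical all_reals all_analysis.
From mathcomp Require Import zify ring lra.
Import Order.TTheory GRing.Theory Num.Theory.
Import numFieldNormedType.Exports.

(* Every integer m in (N, 2N] is 2^e a with a odd, a <= 2N - 1, and m |-> a is
   injective, hence a bijection onto the odd numbers up to 2N - 1. So modulo 1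
   the points x_1, ..., x_N are log2 m for N < m <= 2N, and the pair correlation
   counts the m < m' in this range with m' <= m q, where q = 2^(s/N), apart from
   O(1) pairs that are close around the circle. With t = s ln 2 one has
   N (q - 1) -> t, so a proportion min(1, 2 - d/t) of the m satisfies
   m + d <= m q, and the limit is twice the sum of these over 1 <= d <= 2t. *)

Local Open Scope classical_set_scope.
Local Open Scope ring_scope.

(** * Distance to the nearest integer *)

Lemma dist_intDz (R : realType) (x : R) (m : int) :
  dist_int (x + m%:~R) = dist_int x.
Proof.
rewrite /dist_int; congr inf; apply/seteqP; split => y [k _ <-].
- by exists (k - m) => //=; congr `|_|; rewrite intrD; lra.
- by exists (k + m) => //=; congr `|_|; rewrite intrD; lra.
Qed.

Lemma dist_intN (R : realType) (x : R) : dist_int (- x) = dist_int x.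
Proof.
rewrite /dist_int; congr inf; apply/seteqP; split => y [k _ <-].
- by exists (- k) => //=; rewrite -normrN; congr `|_|; rewrite mulrNz; lra.
- by exists (- k) => //=; rewrite -normrN; congr `|_|; rewrite mulrNz; lra.
Qed.

(** An integer m <= 0 is at distance at least x and an integer m >= 1 at distance at least 1 - x, so
    the infimum is attained at 0 or at 1. *)
Lemma dist_int_unit (R : realType) (x : R) :
  0 <= x <= 1 -> dist_int x = Num.min x (1 - x).
Proof.
move=> /andP[x0 x1]; apply/le_anti/andP; split.
- have lb : has_lbound (range (fun m : int => `|x - m%:~R|)).
    by exists 0 => _ [m _ <-]; exact: normr_ge0.
  rewrite le_min; apply/andP; split; apply: (ge_inf lb).
  + by exists 0 => //=; rewrite subr0 ger0_norm.
  + by exists 1 => //=; rewrite distrC ger0_norm ?subr_ge0.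
- apply: lb_le_inf; first by exists `|x - 0%:~R|, 0.
  move=> _ [m _ <-]; rewrite ge_min.
  have [m0|m1] := leP m 0.
  + have : (m%:~R : R) <= 0 by rewrite lerz0.
    by move=> m0'; rewrite ger0_norm; lra.
  + have : (1 : R) <= m%:~R by rewrite ler1z.
    by move=> m1'; rewrite ler0_norm; lra.
Qed.

Lemma dist_int_le (R : realType) (x r : R) :
  0 <= x <= 1 -> (dist_int x <= r) = (x <= r) || (1 - x <= r).
Proof. by move=> x01; rewrite dist_int_unit // ge_min. Qed.

(** * Odd parts, and the points [xseq] as binary logarithms modulo 1 *)

Local Notation odd_part m := (m`_2^')%N.

(** If the odd parts agree and m has the smaller power of 2, then 2m divides n, which forces n >= 2m
    > 2N. *)
Lemma odd_part_eq (N m n : nat) : (N < m <= N.*2)%N -> (N < n <= N.*2)%N ->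
  odd_part m = odd_part n -> m = n.
Proof.
wlog: m n / (logn 2 m <= logn 2 n)%N.
  move=> W Hm Hn E; have [le|le] := leqP (logn 2 m) (logn 2 n); first exact: W.
  by apply/esym/W => //; exact: ltnW.
move=> le /andP[m0 mN] /andP[n0 nN] E.
have Em := @partnC 2%N m (leq_ltn_trans (leq0n N) m0).
have En := @partnC 2%N n (leq_ltn_trans (leq0n N) n0).
move: Em En; rewrite !p_part E => Em En.
have [e|ne] := eqVneq (logn 2 m) (logn 2 n); first by rewrite e En in Em.
have {ne}lt : (logn 2 m < logn 2 n)%N by rewrite ltn_neqAle ne.
have : (m * 2 %| n)%N.
  rewrite -Em -{2}En mulnAC; apply: dvdn_mul => //.
  by rewrite -expnSr dvdn_exp2l.
by move=> /(dvdn_leq (leq_ltn_trans (leq0n N) n0)); lia.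
Qed.

(* [xseq] at [n] involves the odd number 2n - 1, so the odd part a of m
   corresponds to the index [a./2.+1]. *)
Definition half_odd_part (m : nat) : nat := (odd_part m)./2.

Lemma half_odd_partK (m : nat) : (half_odd_part m).*2.+1 = odd_part m.
Proof.
rewrite /half_odd_part -[RHS]odd_double_half -add1n; congr (_ + _)%N.
by rewrite odd_2'nat part_pnat.
Qed.

Lemma half_odd_part_lt (N m : nat) : (N < m <= N.*2)%N -> (half_odd_part m < N)%N.
Proof.
move=> /andP[Nm mN]; have := half_odd_partK m.
have : (odd_part m <= m)%N by apply: dvdn_leq; [lia | exact: dvdn_part].
lia.
Qed.

(** Passing from m to its odd part lowers log2 m by the integer [logn 2 m], and the fractional part
    removes another integer. *)
Lemma xseq_half_odd_part (R : realType) (m : nat) : (0 < m)%N ->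
  exists k : int, xseq R (half_odd_part m).+1 = ln m%:R / ln 2 + k%:~R.
Proof.
move=> m0; have ln2 : ln (2 : R) != 0 by rewrite gt_eqF // ln_gt0 // ltr1n.
have a0 : 0 < (odd_part m)%:R :> R by rewrite ltr0n part_gt0.
have -> : ln m%:R / ln 2 = ln (odd_part m)%:R / ln 2 + (logn 2 m)%:R :> R.
  rewrite -{1}(partnC 2%N m0) p_part natrM natrX lnM ?posrE ?exprn_gt0 //.
  by rewrite lnXn // -[_ *+ logn _ _]mulr_natr; field.
rewrite /xseq /frac_part.
have -> : 2 * (half_odd_part m).+1%:R - 1 = (odd_part m)%:R :> R.
  by rewrite -half_odd_partK -!natr1 -muln2 natrM; ring.
set f := Num.floor _; exists (- f - (logn 2 m)%:Z).
by rewrite intrD !mulrNz; ring.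
Qed.

Lemma dist_xseq_half_odd_part (R : realType) (m n : nat) : (0 < m)%N -> (0 < n)%N ->
  dist_int (xseq R (half_odd_part m).+1 - xseq R (half_odd_part n).+1) =
  dist_int ((ln m%:R - ln n%:R) / ln 2).
Proof.
move=> m0 n0; have [k ->] := xseq_half_odd_part R m m0.
have [l ->] := xseq_half_odd_part R n n0.
rewrite -[RHS](dist_intDz _ _ (k - l)); congr dist_int.
by rewrite intrB mulrBl; ring.
Qed.

(** * Reduction to close pairs in (N, 2N], sorted by their gap *)

Definition close_pair (R : realType) (s : R) (N i j : nat) : bool :=
  dist_int ((ln (N + i).+1%:R - ln (N + j).+1%:R) / ln 2) <= s / N%:R.

Lemma close_pairC (R : realType) (s : R) (N i j : nat) :
  close_pair R s N i j = close_pair R s N j i.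
Proof. by rewrite /close_pair -dist_intN -mulNr opprB. Qed.

(** Sending i to [half_odd_part (N + i).+1] is an injective self-map of ['I_N], hence a permutation
    along which both indices can be changed. *)
Lemma card_close_pair (R : realType) (s : R) (N : nat) :
  #|[pred p : 'I_N * 'I_N | (p.1 != p.2) &&
      (dist_int (xseq R p.1.+1 - xseq R p.2.+1) <= s / N%:R)]| =
  (\sum_(i < N) \sum_(j < N) ((i != j) && close_pair R s N i j))%N.
Proof.
have itv (i : 'I_N) : (N < (N + i).+1 <= N.*2)%N by have := ltn_ord i; lia.
pose f (i : 'I_N) : 'I_N := Ordinal (half_odd_part_lt _ _ (itv i)).
have f_inj : injective f.
  move=> i j /(congr1 val) /= E; apply/val_inj => /=.
  have := odd_part_eq _ _ _ (itv i) (itv j).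
  by rewrite -!half_odd_partK E => /(_ erefl); lia.
rewrite -sum1_card big_mkcond /=.
rewrite -(pair_big xpredT xpredT (fun i j : 'I_N => if (i != j) &&
  (dist_int (xseq R i.+1 - xseq R j.+1) <= s / N%:R)%R then 1 else 0)%N) /=.
rewrite (reindex_inj f_inj); apply: eq_bigr => i _.
rewrite (reindex_inj f_inj); apply: eq_bigr => j _.
by rewrite inj_eq // [in LHS]dist_xseq_half_odd_part.
Qed.

Lemma sum_neq_sym (N : nat) (E : nat -> nat -> bool) :
  (forall i j, E i j = E j i) ->
  (\sum_(i < N) \sum_(j < N) ((i != j) && E i j) =
   2 * \sum_(i < N) \sum_(j < N) ((i < j) && E i j))%N.
Proof.
move=> EC; rewrite mulSn mul1n.
rewrite [X in (_ + X)%N]exchange_big -big_split; apply: eq_bigr => i _ /=.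
rewrite -big_split; apply: eq_bigr => j _ /=.
by rewrite (EC j i) -(inj_eq val_inj) /=; case: ltngtP; case: (E i j).
Qed.

Lemma sum_gap (N D i : nat) (G : nat -> bool) :
  (i < N)%N -> (forall d, (D <= d)%N -> ~~ G d.+1) ->
  (\sum_(j < N) ((i < j) && G (j - i)) =
   \sum_(d < D) ((i + d.+1 < N) && G d.+1))%N.
Proof.
move=> iN GD.
rewrite -(big_mkord xpredT (fun j => ((i < j) && G (j - i))%N : nat)).
rewrite -(big_mkord xpredT (fun d => ((i + d.+1 < N) && G d.+1)%N : nat)).
(* The range [N + D] covers both cutoffs: terms from [D] on vanish by [GD], and terms from
   [N - i.+1] on because [i + d.+1 < N] fails. *)
transitivity (\sum_(0 <= d < N + D) ((i + d.+1 < N) && G d.+1))%N; last first.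
  rewrite addnC (@big_cat_nat _ _ _ D) ?leq_addr //=.
  rewrite [X in (_ + X)%N]big_nat_cond [X in (_ + X)%N]big1 ?addn0 // => d.
  by rewrite andbT => /andP[Dd _]; rewrite (negbTE (GD _ Dd)) andbF.
rewrite (@big_cat_nat _ _ _ i.+1) //= big_nat_cond big1 ?add0n; last first.
  by move=> j; rewrite andbT => Hj; have -> : (i < j)%N = false by lia.
rewrite -[i.+1]add0n big_addn.
rewrite [RHS](@big_cat_nat _ _ _ (N - i.+1)) //=; last by lia.
rewrite [X in (_ = _ + X)%N]big_nat_cond [X in (_ = _ + X)%N]big1 ?addn0; last first.
  by move=> d; rewrite andbT => H; case: ltnP => //; lia.
rewrite !big_nat; apply: eq_bigr => d Hd.
have -> : (i < d + i.+1)%N by lia.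
have -> : (i + d.+1 < N)%N by lia.
by congr (G _ : nat); lia.
Qed.

(** With m = N + i + 1 < m' = N + j + 1 < 2m, log2 (m' / m) lies in [0, 1], so only the integers 0
    and 1 matter. Exponentiating gives m' <= m q for 0, and 2m <= m' q for 1, that is, closeness
    around the circle. *)
Lemma close_pair_lt (R : realType) (s : R) (N i j : nat) : (i < j < N)%N ->
  let q := expR (s * ln 2 / N%:R) in
  close_pair R s N i j =
    ((j - i)%:R <= (N + i).+1%:R * (q - 1)) ||
    (2 * (N + i).+1%:R <= (N + j).+1%:R * q).
Proof.
move=> /andP[ij jN] q.
have ln2 : 0 < ln (2 : R) by rewrite ln_gt0 // ltr1n.
have mi0 : 0 < (N + i).+1%:R :> R by rewrite ltr0n.
have mj0 : 0 < (N + j).+1%:R :> R by rewrite ltr0n.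
have lnq x : 0 < x -> ln x + s * ln 2 / N%:R = ln (x * q).
  by move=> x0; rewrite lnM ?posrE ?expR_gt0 // expRK.
have sN : s / N%:R * ln 2 = s * ln 2 / N%:R by rewrite mulrAC.
have q0 : 0 < q by exact: expR_gt0.
rewrite close_pairC /close_pair dist_int_le; last first.
  rewrite divr_ge0 ?(ltW ln2) //= ?subr_ge0; last first.
    by rewrite ler_ln ?posrE // ler_nat; lia.
  rewrite ler_pdivrMr // mul1r lerBlDr -lnM ?posrE // ler_ln ?posrE ?mulr_gt0 //.
  by rewrite -natrM ler_nat; lia.
congr (_ || _).
- rewrite ler_pdivrMr // sN lerBlDl lnq // ler_ln ?posrE ?mulr_gt0 //.
  have -> : (N + j).+1%:R = (j - i)%:R + (N + i).+1%:R :> R.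
    by rewrite -natrD; congr _%:R; lia.
  by rewrite mulrBr mulr1 lerBrDr.
- rewrite -[LHS](ler_pM2r ln2) sN mulrBl divfK ?gt_eqF // mul1r.
  rewrite opprB addrA lerBlDr addrC [X in _ <= X]addrC lnq // addrC.
  by rewrite -lnM ?posrE // ler_ln ?posrE ?mulr_gt0.
Qed.

(** * Number of pairs with a given gap *)

Lemma sum_leq_ord (N z : nat) : (\sum_(i < N) (z <= i) = N - z)%N.
Proof.
elim: N => [|N IH]; first by rewrite big_ord0.
by rewrite big_ord_recr /= IH; case: leqP; lia.
Qed.

Lemma sum_ler_ord (R : realType) (N : nat) (y : R) : y <= N%:R ->
  `|(\sum_(i < N) (y <= i%:R)%R)%N%:R - Num.min N%:R (N%:R - y)| <= 1.
Proof.
move=> yN; have [y0|y0] := leP y 0.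
  rewrite (eq_bigr (fun=> 1%N)); last first.
    by move=> i _; rewrite (le_trans y0).
  by rewrite sum1_card card_ord min_l; [rewrite subrr normr0 | lra].
have [z Ez] : exists z : nat, Num.ceil y = z.
  by exists `|Num.ceil y|%N; rewrite gez0_abs // ceil_ge0 (lt_trans _ y0).
have yz (i : nat) : (y <= i%:R) = (z <= i)%N.
  by rewrite -[i%:R]/(i%:~R) -ceil_le_int Ez.
under eq_bigr do rewrite yz.
rewrite sum_leq_ord min_r; last by lra.
have zN : (z <= N)%N by rewrite -yz.
have := ceil_itv y; rewrite Ez intrD => /andP[].
rewrite /= -[z%:~R]/(z%:R) natrB // => H1 H2.
by rewrite ler_norml; apply/andP; split; lra.
Qed.

(* With [e = q - 1], the pairs m = N + i + 1 < m + d <= 2N such that m + d <= m q. *)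
Definition gap_count (R : realType) (N : nat) (e : R) (d : nat) : nat :=
  (\sum_(i < N) ((i + d < N)%N && (d%:R <= (N + i).+1%:R * e)%R))%N.

(** The error [d + 2] collects d for dropping the constraint i + d < N, 1 for the rounding in
    [sum_ler_ord], and 1 because N - y exceeds 2N - d / e by 1. *)
Lemma gap_count_approx (R : realType) (N d : nat) (e : R) :
  0 < e -> d%:R <= 2 * N%:R * e ->
  `|(gap_count R N e d)%:R - Num.min N%:R (2 * N%:R - d%:R / e)| <= d%:R + 2.
Proof.
move=> e0 dN; have dN' : d%:R / e <= 2 * N%:R by rewrite ler_pdivrMr.
pose y : R := d%:R / e - N%:R - 1.
have yN : y <= N%:R by rewrite /y; lra.
have /ler_normlP[B1 B2] := sum_ler_ord R N y yN.
set S := (\sum_(i < N) (y <= i%:R)%R)%N in B1 B2.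
have yE (i : nat) : (d%:R <= (N + i).+1%:R * e) = (y <= i%:R).
  by rewrite -ler_pdivrMr // -natr1 natrD /y !lerBlDr; congr (_ <= _); ring.
have up : (gap_count R N e d <= S)%N.
  by apply: leq_sum => i _; rewrite yE; case: (_ < _)%N.
have lo : (S <= gap_count R N e d + d)%N.
  have : (S <= gap_count R N e d + \sum_(i < N) (N - d <= i)%N)%N.
    rewrite -big_split; apply: leq_sum => i _ /=; rewrite yE.
    case: (ltnP (i + d) N) => /=; first by rewrite leq_addr.
    by move=> H; rewrite leq_subLR [(d + i)%N]addnC H; case: (_ <= _).
  by rewrite sum_leq_ord; lia.
move: up lo; rewrite -!(ler_nat R) natrD => up lo.
have M : `|Num.min N%:R (N%:R - y) - Num.min N%:R (2 * N%:R - d%:R / e)| <= 1.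
  rewrite ler_norml /y; case: (lerP N%:R (N%:R - _)) => H1;
  by case: (lerP N%:R (2 * _ - _)) => H2; apply/andP; split; lra.
move: M => /ler_normlP[M1 M2].
by rewrite ler_norml; apply/andP; split; lra.
Qed.

(** * Limiting proportion for each gap *)

Lemma cvg_near_dist (R : realType) (u v : nat -> R) (K l : R) :
  (\forall n \near \oo, `|u n - v n| <= K / n%:R) ->
  v n @[n --> \oo] --> l -> u n @[n --> \oo] --> l.
Proof.
move=> uv vl.
have K0 : K / n%:R @[n --> \oo] --> (0 : R).
  rewrite -(mulr0 K); apply: cvgM; first exact: cvg_cst.
  rewrite -(cvg_shiftS (fun n => n%:R^-1 : R)); exact: cvg_harmonic.
apply: (@squeeze_cvgr _ _ _ _ (fun n => v n - K / n%:R) (fun n => v n + K / n%:R)).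
- near=> n; have /ler_normlP[H1 H2] : `|u n - v n| <= K / n%:R by near: n.
  by apply/andP; split; lra.
- by rewrite -[l]subr0; apply: cvgB.
- by rewrite -[l]addr0; apply: cvgD.
Unshelve. all: by end_near.
Qed.

(** Both bounds come from 1 + x <= exp x, at x = t / N and at x = - t / N; the latter gives exp (t /
    N) <= 1 / (1 - t / N). *)
Lemma growth_bounds (R : realType) (t : R) (N : nat) : 0 <= t -> t < N%:R ->
  t <= N%:R * (expR (t / N%:R) - 1) <= t / (1 - t / N%:R).
Proof.
move=> t0 tN; have N0 : 0 < N%:R :> R by apply: le_lt_trans tN.
have x1 : 0 < 1 - t / N%:R by rewrite subr_gt0 ltr_pdivrMr // mul1r.
apply/andP; split.
- rewrite -ler_pdivrMl // mulrC; have := expR_ge1Dx (t / N%:R); lra.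
- have := expR_ge1Dx (- (t / N%:R)); rewrite expRN => H.
  have : expR (t / N%:R) <= (1 - t / N%:R)^-1.
    by rewrite -[X in X <= _]invrK lef_pV2 ?posrE ?invr_gt0 ?expR_gt0.
  move=> H2; rewrite -ler_pdivlMl //.
  apply: (le_trans (lerB H2 (lexx 1))).
  by rewrite le_eqVlt; apply/orP; left; apply/eqP; field; lra.
Qed.

Lemma cvg_growth (R : realType) (t : R) : 0 <= t ->
  N%:R * (expR (t / N%:R) - 1) @[N --> \oo] --> t.
Proof.
move=> t0; apply: (@squeeze_cvgr _ _ _ _ (fun=> t)
  (fun N : nat => t / (1 - t / N%:R))).
- near=> N; apply: growth_bounds => //; near: N; exact: nbhs_infty_gtr.
- exact: cvg_cst.
- rewrite -[X in _ --> X](_ : t / (1 - 0) = t); last by rewrite subr0 divr1.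
  apply: cvgM; first exact: cvg_cst.
  apply: cvgV; first by rewrite subr0 oner_neq0.
  apply: cvgB; first exact: cvg_cst.
  apply: (@cvg_near_dist _ _ (fun=> 0) t); last exact: cvg_cst.
  by near=> N; rewrite subr0 ger0_norm // divr_ge0.
Unshelve. all: by end_near.
Qed.

Lemma gap_count_cvg (R : realType) (t : R) (d : nat) :
  0 < t -> d%:R <= 2 * t ->
  (gap_count R N (expR (t / N%:R) - 1) d)%:R / N%:R @[N --> \oo] -->
  Num.min 1 (2 - d%:R / t).
Proof.
move=> t0 dt; pose c (N : nat) : R := N%:R * (expR (t / N%:R) - 1).
apply: (@cvg_near_dist _ _ (fun N => Num.min 1 (2 - d%:R / c N)) (d%:R + 2)).
- near=> N.
  have tN : t < N%:R by near: N; exact: nbhs_infty_gtr.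
  have N0 : 0 < N%:R :> R by apply: lt_trans tN.
  (* The bound t <= N e yields e > 0 and turns d <= 2t into the condition d <= 2 N e of
     [gap_count_approx]. *)
  have /andP[tc _] := growth_bounds _ t N (ltW t0) tN.
  set e := expR (t / N%:R) - 1 in tc *.
  have e0 : 0 < e by rewrite -(pmulr_rgt0 _ N0); exact: lt_le_trans tc.
  have := gap_count_approx R N d e e0.
  have -> : 2 * N%:R - d%:R / e = N%:R * (2 - d%:R / c N).
    by rewrite /c -/e; field; rewrite !gt_eqF.
  rewrite -[X in Num.min X (_ * _)]mulr1 -minr_pMr ?(ltW N0) // => H.
  rewrite ler_pdivlMr // -[X in _ * X](ger0_norm (ltW N0)) -normrM mulrBl.
  rewrite divfK ?gt_eqF // [Num.min _ _ * _]mulrC; apply: H.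
  by rewrite -mulrA (le_trans dt) // ler_pM2l.
(* Written with an absolute value, the minimum passes to the limit by the rules for sums, products
   and norms. *)
- under eq_fun do rewrite minr_absE; rewrite minr_absE.
  have cv : 2 - d%:R / c N @[N --> \oo] --> 2 - d%:R / t.
    apply: cvgB; first exact: cvg_cst.
    apply: cvgM; first exact: cvg_cst.
    by apply: cvgV; [rewrite gt_eqF | apply: cvg_growth; exact: ltW].
  apply: cvgM; last exact: cvg_cst.
  apply: cvgB; first by apply: cvgD => //; exact: cvg_cst.
  by apply: cvg_norm; apply: cvgB => //; exact: cvg_cst.
Unshelve. all: by end_near.
Qed.

(** * Pairs close around the circle, and the limit of the pair correlation *)

Lemma sum_ltn_ord (N z : nat) : (\sum_(i < N) (i < z) = minn N z)%N.
Proof.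
elim: N => [|N IH]; first by rewrite big_ord0 min0n.
by rewrite big_ord_recr /= IH; case: ltnP; lia.
Qed.

(** Since m <= 2N, a gap d <= m e is at most 2 N e < k + 1, so the gaps 1, ..., k account for all
    directly close pairs. The slack [k * k] is for the pairs close around the circle. *)
Lemma sum_close_pair (R : realType) (s : R) (N k : nat) : (0 < N)%N ->
  let e := expR (s * ln 2 / N%:R) - 1 in
  0 <= e -> 2 * N%:R * e < k.+1%:R ->
  (\sum_(d < k) gap_count R N e d.+1 <=
   \sum_(i < N) \sum_(j < N) ((i < j) && close_pair R s N i j) <=
   \sum_(d < k) gap_count R N e d.+1 + k * k)%N.
Proof.
move=> N0 e e0 ek; set M := (\sum_(d < k) _)%N; set T := (\sum_(i < N) _)%N.
pose G (i d : nat) := d%:R <= (N + i).+1%:R * e.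
(* [W] holds only for the pairs that are close around the circle. *)
pose W (i j : nat) := 2 * (N + i).+1%:R <= (N + j).+1%:R * (e + 1).
have TE : T = (\sum_(i < N) \sum_(j < N) ((i < j) && (G i (j - i) || W i j)))%N.
  apply: eq_bigr => i _; apply: eq_bigr => j _.
  case: (ltnP i j) => //= ij; rewrite close_pair_lt ?ij ?ltn_ord //.
  by rewrite /G /W subrK.
have ME : M = (\sum_(i < N) \sum_(j < N) ((i < j) && G i (j - i)))%N.
  rewrite /M /gap_count exchange_big; apply: eq_bigr => i _ /=.
  rewrite (sum_gap N k i) ?ltn_ord // => d kd.
  rewrite /G -ltNge; apply: lt_le_trans (_ : k.+1%:R <= _); last by rewrite ler_nat.
  apply: le_lt_trans ek; rewrite ler_wpM2r // -natrM ler_nat.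
  by have := ltn_ord i; lia.
have WE : (\sum_(i < N) \sum_(j < N) ((i < j) && W i j) <= k * k)%N.
  apply: (@leq_trans (\sum_(i < N) \sum_(j < N) ((i < k) * (N - k <= j))))%N.
    apply: leq_sum => i _; apply: leq_sum => j _; case: (_ < j)%N => //=.
    case WH : (W i j) => //.
    (* The left side is 2 (N + i + 1) - (N + j + 1), which [W] bounds by (N + j + 1) e <= 2 N e.
       Hence i is among the first k indices and j among the last k. *)
    have H : (i.*2.+1 + (N - j) < k.+1)%N.
      rewrite -(ltr_nat R); apply: le_lt_trans ek.
      move: WH; rewrite /W mulrDr mulr1.
      have : (N + j).+1%:R * e <= 2 * N%:R * e.
        by rewrite ler_wpM2r // -natrM ler_nat; have := ltn_ord j; lia.
      rewrite natrD natrB ?(ltnW (ltn_ord j)) // -!natr1 !natrD -muln2 natrM.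
      lra.
    have -> : (i < k)%N by lia.
    by have -> : (N - k <= j)%N by lia.
  under eq_bigr do rewrite -big_distrr.
  by rewrite -big_distrl /= sum_ltn_ord sum_leq_ord; apply: leq_mul; lia.
rewrite TE ME; apply/andP; split.
  by apply: leq_sum => i _; apply: leq_sum => j _; case: (_ < j)%N => //; case: (G _ _).
apply: leq_trans (leq_add (leqnn _) WE).
rewrite -big_split; apply: leq_sum => i _; rewrite -big_split; apply: leq_sum => j _ /=.
by case: (_ < j)%N => //; case: (G _ _) => //; case: (W _ _).
Qed.

(** As N e tends to t, the strict bound 2t < k + 1 gives 2 N e < k + 1 for large N. The error k * k
    of [sum_close_pair] then vanishes after division by N. *)
Lemma pair_corr_cvg (R : realType) (s : R) (k : nat) : 0 <= s ->
  k%:R <= 2 * (s * ln 2) < k.+1%:R ->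
  pair_corr s N @[N --> \oo] -->
  2 * \sum_(d < k) Num.min 1 (2 - d.+1%:R / (s * ln 2)).
Proof.
move=> s0; have ln2 : 0 < ln (2 : R) by rewrite ln_gt0 // ltr1n.
set t := s * ln 2 => /andP[kt tk].
have t0 : 0 <= t by rewrite mulr_ge0 // ltW.
pose e (N : nat) := expR (t / N%:R) - 1.
apply: (@cvg_near_dist _ _ (fun N =>
  2 * \sum_(d < k) (gap_count R N (e N) d.+1)%:R / N%:R) (2 * (k * k)%:R)).
- have tk' : t < k.+1%:R / 2 by lra.
  have ck : \forall N \near \oo, N%:R * e N < k.+1%:R / 2.
    exact: (cvgr_lt _ (cvg_growth _ t t0) _ tk').
  near=> N.
  have N0 : (0 < N)%N by near: N; exact: nbhs_infty_gt.
  have N0' : 0 < N%:R :> R by rewrite ltr0n.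
  have cN : 2 * N%:R * e N < k.+1%:R.
    have : N%:R * e N < k.+1%:R / 2 by near: N.
    by rewrite -mulrA; lra.
  have e0 : 0 <= e N.
    by rewrite subr_ge0 -[X in X <= _]expR0 ler_expR divr_ge0.
  have /andP[] := sum_close_pair R s N k N0 e0 cN.
  rewrite /pair_corr card_close_pair.
  rewrite (@sum_neq_sym N (close_pair R s N)); last exact: close_pairC.
  set T := (\sum_(i < N) _)%N.
  rewrite -mulr_suml -natr_sum; set M := (\sum_(d < k) _)%N.
  rewrite -!(ler_nat R) natrD => H1 H2.
  have -> : N%:R^-1 * (2 * T)%N%:R - 2 * (M%:R / N%:R) = 2 * (T%:R - M%:R) / N%:R :> R.
    by rewrite natrM; ring.
  rewrite normrM normfV [`|N%:R|]ger0_norm ?(ltW N0') // ler_pM2r ?invr_gt0 //.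
  rewrite normrM ger0_norm // ler_pM2l // ger0_norm; lra.
- apply: cvgM; first exact: cvg_cst.
  apply: (cvg_big (op := +%R)); first exact: add_continuous.
  (* Any term of the sum forces t > 0, as 1 <= d + 1 <= 2t; when t = 0 the sum is empty. *)
  move=> d _; have dt : d.+1%:R <= 2 * t.
    by apply: le_trans kt; rewrite ler_nat; exact: ltn_ord.
  apply: gap_count_cvg => //.
  by have := ltr0Sn R d; lra.
Unshelve. all: by end_near.
Qed.

(** * Closed form of the limit *)

(** Here j is the integer part of t: the minimum is 1 for gaps up to j and 2 - d / t beyond, and the
    latter terms are added by induction on k - j. *)
Lemma sum_min_closed (R : realType) (t : R) (j k : nat) :
  0 < t -> j%:R <= t < j.+1%:R -> (j <= k)%N ->
  \sum_(d < k) Num.min 1 (2 - d.+1%:R / t) =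
  2 * k%:R - j%:R - (k%:R * (k%:R + 1) - j%:R * (j%:R + 1)) / (2 * t).
Proof.
move=> t0 /andP[jt tj] jk.
have {jk}[n ->] : exists n, k = (j + n)%N by exists (k - j)%N; rewrite subnKC.
elim: n => [|n IH].
  rewrite addn0 subrr mul0r subr0 (eq_bigr (fun=> 1)).
    by rewrite sumr_const card_ord; ring.
  move=> d _; rewrite min_l // lerBrDl -lerBrDr; have -> : 2 - 1 = 1 :> R by lra.
  by rewrite ler_pdivrMr // mul1r (le_trans _ jt) // ler_nat.
rewrite addnS big_ord_recr /= IH min_r; last first.
  rewrite lerBlDl -lerBlDr; have -> : 2 - 1 = 1 :> R by lra.
  by rewrite ler_pdivlMr // mul1r (le_trans (ltW tj)) // ler_nat ltnS leq_addr.
by rewrite -[(j + n).+1%:R]natr1; field; rewrite gt_eqF.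
Qed.

Theorem theorem1p1 (R : realType) (s : R) (hs : 0 <= s) :
  cvg (pair_corr s N @[N --> \oo]) /\
  (s < 1 / ln 4 -> lim (pair_corr s N @[N --> \oo]) = 0) /\
  (forall k : nat, (0 < k)%N -> ~~ odd k ->
     k%:R / ln 4 <= s -> s < (k%:R + 1) / ln 4 ->
     lim (pair_corr s N @[N --> \oo]) =
       3 * k%:R - (3 * k%:R ^+ 2 + 2 * k%:R) / (4 * ln 2 * s)) /\
  (forall k : nat, (0 < k)%N -> odd k ->
     k%:R / ln 4 <= s -> s < (k%:R + 1) / ln 4 ->
     lim (pair_corr s N @[N --> \oo]) =
       3 * k%:R + 1 - (3 * k%:R ^+ 2 + 4 * k%:R + 1) / (4 * ln 2 * s)).
Proof.
have ln2 : 0 < ln (2 : R) by rewrite ln_gt0 // ltr1n.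
have ln4 : ln (4 : R) = 2 * ln 2.
  by rewrite (_ : 4 = 2 ^+ 2) ?lnXn ?mulr_natl //; lra.
have ln4_gt0 : 0 < ln (4 : R) by rewrite ln4 mulr_gt0.
set t := s * ln 2.
have st : s * ln 4 = 2 * t by rewrite ln4 /t; ring.
have limE (k : nat) : k%:R / ln 4 <= s -> s < (k%:R + 1) / ln 4 ->
    lim (pair_corr s N @[N --> \oo]) =
      2 * \sum_(d < k) Num.min 1 (2 - d.+1%:R / t) /\ k%:R <= 2 * t < k%:R + 1.
  rewrite ler_pdivrMr // ltr_pdivlMr // st => kt tk; split; last by rewrite kt.
  by apply/cvg_lim => //; apply: pair_corr_cvg => //; rewrite -/t kt -[k.+1%:R]natr1.
have closed (k j : nat) : (0 < k)%N -> (j <= k)%N -> k%:R <= 2 * t ->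
    j%:R <= t < j.+1%:R ->
    2 * \sum_(d < k) Num.min 1 (2 - d.+1%:R / t) =
    2 * (2 * k%:R - j%:R) - (k%:R * (k%:R + 1) - j%:R * (j%:R + 1)) / (ln 2 * s).
  move=> k0 jk kt jt; have t0 : 0 < t.
    by have : 0 < k%:R :> R by [rewrite ltr0n]; lra.
  have s0 : s != 0 by apply: contraTneq t0; rewrite /t => ->; rewrite mul0r ltxx.
  rewrite (sum_min_closed _ _ j) // /t.
  by field; rewrite s0 gt_eqF.
do !split.
- have t0 : 0 <= 2 * t by rewrite mulr_ge0 // mulr_ge0 // ltW.
  (* The integer part of 2t is a suitable k for every s >= 0. *)
  apply/cvg_ex; eexists; apply: (pair_corr_cvg _ _ (Num.truncn (2 * t))) => //.
  by rewrite -/t truncn_itv.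
- by move=> s1; rewrite (proj1 (limE 0%N _ _)) ?mul0r ?add0r // big_ord0 mulr0.
- move=> k k0 kE kt tk; have [-> /andP[{}kt {}tk]] := limE k kt tk.
  have Ek : k = (k./2.*2)%N by rewrite even_halfK.
  have Er : k%:R = 2 * k./2%:R :> R by rewrite {1}Ek -mul2n natrM.
  (* For k = 2j, t lies in [j, j + 1/2), so its integer part is j. *)
  rewrite (closed _ k./2) //; [|lia|by rewrite -natr1; apply/andP; split; lra].
  have s0 : s != 0.
    apply: contraTneq kt => s0; rewrite /t s0 mul0r mulr0 -ltNge ltr0n //.
  by rewrite Er; field; rewrite s0 gt_eqF.
- move=> k k0 kO kt tk; have [-> /andP[{}kt {}tk]] := limE k kt tk.
  have Ek : k = (k./2.*2.+1)%N by rewrite odd_halfK //; lia.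
  have Er : k%:R = 2 * k./2%:R + 1 :> R by rewrite {1}Ek -natr1 -mul2n natrM.
  (* For k = 2j + 1, t lies in [j + 1/2, j + 1), so its integer part is again j. *)
  rewrite (closed _ k./2) //; [|lia|by rewrite -natr1; apply/andP; split; lra].
  have s0 : s != 0.
    apply: contraTneq kt => s0; rewrite /t s0 mul0r mulr0 -ltNge ltr0n //.
  by rewrite Er; field; rewrite s0 gt_eqF.
Qed.
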